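(* Let $\sigma>2$ and let $F(a,b)=\operatorname{sgn}(\sigma)\,K^{\sigma/2}=(ab)^{\sigma/2}$ for $a,b>0$, where $K=ab$. Then there exists no maximum-principle function (MPF) for the normal velocity $F$.
   Context: Notation: $\mathbb{R}^2_+=(0,\infty)^2$; subscripts $a,b$ denote partial derivatives. Normal velocity: a symmetric function $F\in C^2(\mathbb{R}^2_+)$, homogeneous of some degree $\sigma\in\mathbb{R}\setminus\{0\}$, with $F_a,F_b>0$ for all $a,b>0$. It is contracting if $F>0$ everywhere on $\mathbb{R}^2_+$ and expanding if $F<0$ everywhere on $\mathbb{R}^2_+$. Maximum-principle function (MPF) for a normal velocity $F$: a symmetric function $w\in C^2(\mathbb{R}^2_+)$, homogeneous of some degree $\chi\in\mathbb{R}\setminus\{0\}$, such that, with $\alpha=-w_a/w_b$ and $\alpha_a=\partial\alpha/\partial a$ (defined for $a\ne b$): (1) $w>0$ whenever $a\neq b$, and $w=0$ whenever $a=b$. (2) $\chi>0$ if $F$ is contracting, $\chi<0$ if $F$ is expanding. (3) $w_a<0$ for all $0<a<b$, and $w_a>0$ for all $0<b<a$. (4) For all $a,b>0$ (for $E_w,G_w$: $a\neq b$) one has $C_w(a,b)\le0$, $E_w(a,b)\le0$, $G_w(a,b)\le 0$, where $$C_w=w_a\,a\big((F_aa^2+F_bb^2)+(F-F_aa-F_bb)a\big)+w_b\,b\big((F_aa^2+F_bb^2)+(F-F_aa-F_bb)b\big),$$ $$E_w=w_a(F_{aa}+2F_{ab}\alpha+F_{bb}\alpha^2)-F_a(w_{aa}+2w_{ab}\alpha+w_{bb}\alpha^2)+2\,\frac{w_bF_a-w_aF_b}{a-b}\,\alpha^2,$$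 $$G_w=\frac1{\alpha^2}\Big(w_b(F_{aa}+2F_{ab}\alpha+F_{bb}\alpha^2)-F_b(w_{aa}+2w_{ab}\alpha+w_{bb}\alpha^2)+2\,\frac{w_bF_a-w_aF_b}{a-b}\Big).$$ (5) There are constants $c>0$, $d\in\mathbb{R}$ such that, evaluating $\alpha$ and $\alpha_a$ at $(a,b)=(\rho,1)$ with $0<\rho<1$: if $F$ is contracting, then either $\alpha=c$ and $\alpha_a=0$ for all sufficiently small $\rho$, or, as $\rho\to0$, $\alpha=\frac c\rho+o(\rho^{-1})$ and $\alpha_a=-\frac c{\rho^2}+o(\rho^{-1})$; if $F$ is expanding, then, as $\rho\to0$, either $\alpha=\frac c\rho+o(\rho^{-1})$ and $\alpha_a=-\frac c{\rho^2}+o(\rho^{-1})$, or $\alpha=\frac{c+d\rho}{\rho^2}+o(\rho^{-1})$ and $\alpha_a=-\frac{2c+d\rho}{\rho^3}+o(\rho^{-1})$. *)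

(* Defs.v *)
From Stdlib Require Import Reals Lra Lia.
From Coquelicot Require Import Coquelicot.
Open Scope R_scope.

(** A function on the open quadrant (0,oo)^2 is represented by a total function
    [R -> R -> R]; every notion below depends only on its values at positive
    arguments. *)

Definition d_a (f : R -> R -> R) (a b : R) : R := Derive (fun x => f x b) a.
Definition d_b (f : R -> R -> R) (a b : R) : R := Derive (fun y => f a y) b.

Definition C2_quadrant (f : R -> R -> R) : Prop :=
  forall a b, 0 < a -> 0 < b -> ex_diff_n f 2 a b.

Definition symmetric_quadrant (f : R -> R -> R) : Prop :=
  forall a b, 0 < a -> 0 < b -> f a b = f b a.

Definition homogeneous_quadrant (k : R) (f : R -> R -> R) : Prop :=
  forall t a b, 0 < t -> 0 < a -> 0 < b ->
    f (t * a) (t * b) = Rpower t k * f a b.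

Definition normal_velocity (F : R -> R -> R) : Prop :=
  symmetric_quadrant F /\
  C2_quadrant F /\
  (exists sigma, sigma <> 0 /\ homogeneous_quadrant sigma F) /\
  (forall a b, 0 < a -> 0 < b -> 0 < d_a F a b /\ 0 < d_b F a b).

Definition contracting (F : R -> R -> R) : Prop :=
  forall a b, 0 < a -> 0 < b -> 0 < F a b.

Definition expanding (F : R -> R -> R) : Prop :=
  forall a b, 0 < a -> 0 < b -> F a b < 0.

Definition alpha (w : R -> R -> R) (a b : R) : R := - d_a w a b / d_b w a b.

(** Second derivative of [f] in the direction (1, alpha), where alpha is formed
    from [w] : f_aa + 2 f_ab alpha + f_bb alpha^2. *)
Definition hess_alpha (w f : R -> R -> R) (a b : R) : R :=
  d_a (d_a f) a b + 2 * d_b (d_a f) a b * alpha w a b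
  + d_b (d_b f) a b * (alpha w a b) ^ 2.

Definition C_mpf (F w : R -> R -> R) (a b : R) : R :=
  let P := d_a F a b * a ^ 2 + d_b F a b * b ^ 2 in
  let Q := F a b - d_a F a b * a - d_b F a b * b in
  d_a w a b * a * (P + Q * a) + d_b w a b * b * (P + Q * b).

Definition E_mpf (F w : R -> R -> R) (a b : R) : R :=
  d_a w a b * hess_alpha w F a b
  - d_a F a b * hess_alpha w w a b
  + 2 * ((d_b w a b * d_a F a b - d_a w a b * d_b F a b) / (a - b))
      * (alpha w a b) ^ 2.

Definition G_mpf (F w : R -> R -> R) (a b : R) : R :=
  1 / (alpha w a b) ^ 2 *
  (d_b w a b * hess_alpha w F a b
   - d_b F a b * hess_alpha w w a b
   + 2 * ((d_b w a b * d_a F a b - d_a w a b * d_b F a b) / (a - b))).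

(** [f rho = g rho + o (1 / rho)] as [rho] tends to 0 from the right. *)
Definition eq_up_to_o_inv (f g : R -> R) : Prop :=
  is_domin (at_right 0) (fun rho => / rho) (fun rho => f rho - g rho).

Definition alpha_1 (w : R -> R -> R) (rho : R) : R := alpha w rho 1.
Definition alpha_a_1 (w : R -> R -> R) (rho : R) : R := d_a (alpha w) rho 1.

Definition alpha_constant_near_0 (w : R -> R -> R) (c : R) : Prop :=
  at_right 0 (fun rho => alpha_1 w rho = c /\ alpha_a_1 w rho = 0).

Definition alpha_order_1 (w : R -> R -> R) (c : R) : Prop :=
  eq_up_to_o_inv (alpha_1 w) (fun rho => c / rho) /\
  eq_up_to_o_inv (alpha_a_1 w) (fun rho => - (c / rho ^ 2)).

Definition alpha_order_2 (w : R -> R -> R) (c d : R) : Prop :=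
  eq_up_to_o_inv (alpha_1 w) (fun rho => (c + d * rho) / rho ^ 2) /\
  eq_up_to_o_inv (alpha_a_1 w) (fun rho => - ((2 * c + d * rho) / rho ^ 3)).

Definition is_MPF (F w : R -> R -> R) : Prop :=
  symmetric_quadrant w /\
  C2_quadrant w /\
  (exists chi, chi <> 0 /\ homogeneous_quadrant chi w /\
     (contracting F -> 0 < chi) /\ (expanding F -> chi < 0)) /\
  (forall a b, 0 < a -> 0 < b -> a <> b -> 0 < w a b) /\
  (forall a, 0 < a -> w a a = 0) /\
  (forall a b, 0 < a -> a < b -> d_a w a b < 0) /\
  (forall a b, 0 < b -> b < a -> 0 < d_a w a b) /\
  (forall a b, 0 < a -> 0 < b -> C_mpf F w a b <= 0) /\
  (forall a b, 0 < a -> 0 < b -> a <> b ->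
     E_mpf F w a b <= 0 /\ G_mpf F w a b <= 0) /\
  (exists c d, 0 < c /\
     (contracting F -> alpha_constant_near_0 w c \/ alpha_order_1 w c) /\
     (expanding F -> alpha_order_1 w c \/ alpha_order_2 w c d)).

(** sgn(sigma) K^(sigma/2) with K = a b. *)
Definition gauss_power (sigma : R) (a b : R) : R :=
  sign sigma * Rpower (a * b) (sigma / 2).

Lemma locally_2d_quadrant (P : R -> R -> Prop) a b :
  0 < a -> 0 < b -> (forall u v, 0 < u -> 0 < v -> P u v) -> locally_2d P a b.
Proof.
intros Ha Hb H.
assert (Hm : 0 < Rmin a b) by (apply Rmin_glb_lt; assumption).
exists (mkposreal _ Hm); simpl; intros u v Hu Hv.
apply Rabs_def2 in Hu; apply Rabs_def2 in Hv.
pose proof (Rmin_l a b); pose proof (Rmin_r a b).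
apply H; lra.
Qed.

Definition monomial (k p q a b : R) : R := k * (Rpower a p * Rpower b q).

Lemma is_derive_monomial_a k p q a b : 0 < a ->
  is_derive (fun x => monomial k p q x b) a (monomial (k * p) (p - 1) q a b).
Proof.
intros Ha.
assert (H : is_derive (fun x => Rpower x p) a (p * Rpower a (p - 1))).
{ apply is_derive_Reals, derivable_pt_lim_power, Ha. }
unfold monomial.
apply is_derive_ext with (fun x => (k * Rpower b q) * Rpower x p).
{ intros t; simpl; ring. }
replace (k * p * (Rpower a (p - 1) * Rpower b q))
  with ((k * Rpower b q) * (p * Rpower a (p - 1))) by ring.
apply (is_derive_scal _ _ _ _ H).
Qed.

Lemma monomial_swap k p q a b : monomial k p q a b = monomial k q p b a.
Proof. unfold monomial; ring. Qed.

Lemma is_derive_monomial_b k p q a b : 0 < b ->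
  is_derive (fun y => monomial k p q a y) b (monomial (k * q) p (q - 1) a b).
Proof.
intros Hb.
apply is_derive_ext with (fun y => monomial k q p y a).
{ intros t; apply monomial_swap. }
rewrite monomial_swap; apply is_derive_monomial_a, Hb.
Qed.

Lemma ex_diff_n_monomial n : forall k p q a b, 0 < a -> 0 < b ->
  ex_diff_n (monomial k p q) n a b.
Proof.
assert (Hc : forall k p q a b, 0 < a -> 0 < b ->
  continuity_2d_pt (monomial k p q) a b).
{ intros k p q a b Ha Hb; unfold monomial.
  assert (Hp : forall x r, 0 < x -> continuity_pt (fun t => Rpower t r) x).
  { intros x r Hx; apply derivable_continuous_pt.
    exists (r * Rpower x (r - 1)); apply derivable_pt_lim_power, Hx. }
  apply continuity_2d_pt_mult; [apply continuity_2d_pt_const |].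
  apply continuity_2d_pt_mult.
  - apply (continuity_1d_2d_pt_comp (fun t => Rpower t p) (fun u _ => u));
      [apply Hp, Ha | apply continuity_2d_pt_id1].
  - apply (continuity_1d_2d_pt_comp (fun t => Rpower t q) (fun _ v => v));
      [apply Hp, Hb | apply continuity_2d_pt_id2]. }
induction n as [|n IH]; intros k p q a b Ha Hb; simpl; split; auto.
repeat split.
- eexists; apply is_derive_monomial_a, Ha.
- eexists; apply is_derive_monomial_b, Hb.
- apply ex_diff_n_ext_loc with (monomial (k * p) (p - 1) q); [|auto].
  apply locally_2d_quadrant; auto; intros u v Hu Hv.
  symmetry; apply is_derive_unique, is_derive_monomial_a, Hu.
- apply ex_diff_n_ext_loc with (monomial (k * q) p (q - 1)); [|auto].
  apply locally_2d_quadrant; auto; intros u v Hu Hv.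
  symmetry; apply is_derive_unique, is_derive_monomial_b, Hv.
Qed.

Lemma gauss_power_monomial sigma a b : 0 < sigma -> 0 < a -> 0 < b ->
  gauss_power sigma a b = monomial 1 (sigma / 2) (sigma / 2) a b.
Proof.
intros Hs Ha Hb; unfold gauss_power, monomial.
rewrite (sign_eq_1 _ Hs), Rpower_mult_distr; auto.
Qed.

Lemma gauss_power_normal_velocity sigma :
  0 < sigma -> normal_velocity (gauss_power sigma).
Proof.
intros Hs.
assert (Hpos : forall k p q a b, 0 < k -> 0 < monomial k p q a b).
{ intros; unfold monomial, Rpower.
  repeat apply Rmult_lt_0_compat; auto using exp_pos. }
assert (Hloc : forall a b, 0 < a -> 0 < b -> locally_2d (fun u v =>
  monomial 1 (sigma / 2) (sigma / 2) u v = gauss_power sigma u v) a b).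
{ intros a b Ha Hb; apply locally_2d_quadrant; auto; intros u v Hu Hv.
  symmetry; apply gauss_power_monomial; auto. }
split; [|split; [|split]].
- intros a b _ _; unfold gauss_power; now rewrite (Rmult_comm a b).
- intros a b Ha Hb; eapply ex_diff_n_ext_loc; [apply Hloc; auto|].
  apply ex_diff_n_monomial; auto.
- exists sigma; split; [lra|].
  intros t a b Ht Ha Hb; unfold gauss_power.
  replace (t * a * (t * b)) with ((t * t) * (a * b)) by ring.
  rewrite <- (Rpower_mult_distr (t * t)), <- (Rpower_mult_distr t t), <- Rpower_plus;
    auto using Rmult_lt_0_compat.
  replace (sigma / 2 + sigma / 2) with sigma by field; ring.
- intros a b Ha Hb; unfold d_a, d_b; split.
  + rewrite (Derive_ext_loc _ (fun x => monomial 1 (sigma / 2) (sigma / 2) x b)).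
    2: { generalize (locally_2d_1d_const_y _ _ _ (Hloc a b Ha Hb)).
         apply filter_imp; intros x Hx; now symmetry. }
    rewrite (is_derive_unique _ _ _ (is_derive_monomial_a _ _ _ a b Ha)).
    apply Hpos; lra.
  + rewrite (Derive_ext_loc _ (fun y => monomial 1 (sigma / 2) (sigma / 2) a y)).
    2: { generalize (locally_2d_1d_const_x _ _ _ (Hloc a b Ha Hb)).
         apply filter_imp; intros y Hy; now symmetry. }
    rewrite (is_derive_unique _ _ _ (is_derive_monomial_b _ _ _ a b Hb)).
    apply Hpos; lra.
Qed.

(* Main.v *)
Require Import Defs.
From Stdlib Require Import Reals Lra.
From Coquelicot Require Import Coquelicot.
Open Scope R_scope.

(** Only the limit of [G <= 0] at the boundary ray [rho -> 0] of [(rho, 1)] is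
    needed.  Put [s = sigma / 2 > 1], [beta = rho alpha] and
    [gamma = rho^2 alpha_a].  Euler's relation turns the Hessian term of [w] into
    [- w_b alpha_a (1 - beta)], so that, up to a positive factor, [G] equals
    [(s-1) + 2 s beta + (s-1) beta^2 + gamma (1 - beta)
      - 2 rho (1 + beta) / (1 - rho)].
    Both admissible asymptotics make [gamma (1 - beta)] at least
    [- beta + beta^2] up to a small multiple of [1 + beta], and the remaining
    terms dominate [(s-1) (1 + beta)], so [G > 0] for small [rho]. *)

Lemma locally_pos (P : R -> Prop) x :
  0 < x -> (forall y, 0 < y -> P y) -> locally x P.
Proof.
intros Hx H.
apply filter_imp with (fun y => 0 < y); [exact H|].
apply (open_gt 0 x Hx).
Qed.

Lemma Rpower_pred a p : 0 < a -> Rpower a (p - 1) = Rpower a p / a.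
Proof.
intros Ha; unfold Rminus; rewrite Rpower_plus, Rpower_Ropp, Rpower_1; auto.
Qed.

Lemma homogeneous_swap k f :
  homogeneous_quadrant k f -> homogeneous_quadrant k (fun a b => f b a).
Proof. intros H t a b Ht Ha Hb; apply H; assumption. Qed.

(** Scaling turns [f x (t * b)] into [t^k] times [f (x / t) b]; the chain rule at [x = t * a] then
    contributes the factor [1 / t] that lowers the degree. *)
Lemma homogeneous_d_a k f :
  (forall a b, 0 < a -> 0 < b -> ex_derive (fun x => f x b) a) ->
  homogeneous_quadrant k f -> homogeneous_quadrant (k - 1) (d_a f).
Proof.
intros Hd Hf t a b Ht Ha Hb; unfold d_a at 1.
apply is_derive_unique.
apply is_derive_ext_loc with (fun x => Rpower t k * f (x / t) b).
{ apply locally_pos; [now apply Rmult_lt_0_compat|]; intros x Hx.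
  rewrite <- Hf; auto using Rdiv_lt_0_compat.
  f_equal; field; lra. }
rewrite Rpower_pred by assumption; unfold Rdiv at 2.
rewrite Rmult_assoc; apply (is_derive_scal _ _ (Rpower t k)).
apply (is_derive_comp (fun x => f x b) (fun x => x / t)).
- replace (t * a / t) with a by (field; lra).
  apply Derive_correct, Hd; assumption.
- auto_derive; [trivial | field; lra].
Qed.

Lemma homogeneous_d_b k f :
  (forall a b, 0 < a -> 0 < b -> ex_derive (fun y => f a y) b) ->
  homogeneous_quadrant k f -> homogeneous_quadrant (k - 1) (d_b f).
Proof.
intros Hd Hf.
apply (homogeneous_swap _ (d_a (fun x y => f y x))).
apply homogeneous_d_a; [intros a b Ha Hb; now apply Hd|].
now apply homogeneous_swap.
Qed.

(** Writing [f a y] as [y^k * f (a / y) 1] moves the second variable into the first, so a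
    one-variable chain rule at [y = 1] yields [d_b], existence included. *)
Lemma euler_relation k f a :
  homogeneous_quadrant k f -> 0 < a -> ex_derive (fun x => f x 1) a ->
  d_b f a 1 = k * f a 1 - a * d_a f a 1.
Proof.
intros Hf Ha Hd; unfold d_b; apply is_derive_unique.
apply is_derive_ext_loc with (fun y => Rpower y k * f (a / y) 1).
{ apply locally_pos; [lra|]; intros y Hy.
  rewrite <- Hf; auto using Rdiv_lt_0_compat, Rlt_0_1.
  f_equal; field; lra. }
assert (Hp : is_derive (fun y => Rpower y k) 1 k).
{ apply is_derive_Reals.
  pose proof (derivable_pt_lim_power 1 k Rlt_0_1) as H.
  replace (k * Rpower 1 (k - 1)) with k in H; [exact H|].
  unfold Rpower; rewrite ln_1, Rmult_0_r, exp_0; ring. }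
assert (Hc : is_derive (fun y => f (a / y) 1) 1 (- a * d_a f a 1)).
{ apply (is_derive_comp (fun x => f x 1) (fun y => a / y)).
  - replace (a / 1) with a by field; now apply Derive_correct.
  - auto_derive; [lra | field]. }
replace (k * f a 1 - a * d_a f a 1)
  with (k * f (a / 1) 1 + Rpower 1 k * (- a * d_a f a 1)).
2: { replace (a / 1) with a by field.
     unfold Rpower; rewrite ln_1, Rmult_0_r, exp_0; ring. }
apply (is_derive_mult _ _ _ _ _ Hp Hc Rmult_comm).
Qed.

Lemma C2_quadrant_derivable f : C2_quadrant f ->
  (forall a b, 0 < a -> 0 < b -> ex_derive (fun x => f x b) a) /\
  (forall a b, 0 < a -> 0 < b -> ex_derive (fun y => f a y) b) /\
  (forall a b, 0 < a -> 0 < b -> ex_derive (fun x => d_a f x b) a) /\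
  (forall a b, 0 < a -> 0 < b -> ex_derive (fun x => d_b f x b) a).
Proof.
intros H; repeat split; intros a b Ha Hb;
  destruct (H a b Ha Hb) as (_ & H1 & H2 & (_ & H3 & _) & (_ & H4 & _));
  assumption.
Qed.

(** Differentiating w_a = - alpha w_b gives w_aa + alpha w_ab = - w_b alpha_a and w_ab + alpha w_bb
    = - w_b alpha_b. Since alpha has degree 0, alpha_b = - a alpha_a at b = 1. The proof checks this
    by eliminating second derivatives through Euler's relation. *)
Lemma hess_alpha_homogeneous chi w a :
  C2_quadrant w -> homogeneous_quadrant chi w -> 0 < a -> d_b w a 1 <> 0 ->
  hess_alpha w w a 1 = - d_b w a 1 * d_a (alpha w) a 1 * (1 - a * alpha w a 1).
Proof.
intros HC Hh Ha Hb0.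
destruct (C2_quadrant_derivable w HC) as (Da & Db & Daa & Dba).
specialize (Daa a 1 Ha Rlt_0_1); specialize (Dba a 1 Ha Rlt_0_1).
assert (Ea : d_b (d_a w) a 1 = (chi - 1) * d_a w a 1 - a * d_a (d_a w) a 1).
{ apply euler_relation; [now apply homogeneous_d_a | exact Ha | exact Daa]. }
assert (Eb : d_b (d_b w) a 1 = (chi - 1) * d_b w a 1 - a * d_a (d_b w) a 1).
{ apply euler_relation; [now apply homogeneous_d_b | exact Ha | exact Dba]. }
(* Schwarz's equality comes here from differentiating Euler's relation. *)
assert (Es : d_a (d_b w) a 1 = (chi - 1) * d_a w a 1 - a * d_a (d_a w) a 1).
{ unfold d_a at 1; apply is_derive_unique.
  apply is_derive_ext_loc with (fun x => chi * w x 1 - x * d_a w x 1).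
  { apply locally_pos; auto; intros x Hx; symmetry.
    apply euler_relation; [exact Hh | exact Hx | exact (Da x 1 Hx Rlt_0_1)]. }
  auto_derive.
  - repeat split; [exact (Da a 1 Ha Rlt_0_1) | exact Daa].
  - unfold d_a; ring. }
assert (Ed : d_a (alpha w) a 1
  = - (d_a (d_a w) a 1 * d_b w a 1 - d_a w a 1 * d_a (d_b w) a 1)
    / d_b w a 1 ^ 2).
{ unfold d_a at 1; apply is_derive_unique; unfold alpha.
  auto_derive; [repeat split; auto|].
  change (Derive (fun x => d_a w x 1) a) with (d_a (d_a w) a 1).
  change (Derive (fun x => d_b w x 1) a) with (d_a (d_b w) a 1).
  field; auto. }
unfold hess_alpha; rewrite Ed, Ea, Eb, Es; unfold alpha; field; auto.
Qed.

(** Conclusion and hypothesis have the same shape, so second derivatives follow by chaining. *)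
Lemma d_a_monomial f k p q :
  (forall a b, 0 < a -> 0 < b -> f a b = monomial k p q a b) ->
  forall a b, 0 < a -> 0 < b -> d_a f a b = monomial (k * p) (p - 1) q a b.
Proof.
intros H a b Ha Hb; unfold d_a; apply is_derive_unique.
apply is_derive_ext_loc with (fun x => monomial k p q x b).
- apply locally_pos; auto; intros x Hx; symmetry; auto.
- now apply is_derive_monomial_a.
Qed.

Lemma d_b_monomial f k p q :
  (forall a b, 0 < a -> 0 < b -> f a b = monomial k p q a b) ->
  forall a b, 0 < a -> 0 < b -> d_b f a b = monomial (k * q) p (q - 1) a b.
Proof.
intros H a b Ha Hb; unfold d_b; apply is_derive_unique.
apply is_derive_ext_loc with (fun y => monomial k p q a y).
- apply locally_pos; auto; intros y Hy; symmetry; auto.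
- now apply is_derive_monomial_b.
Qed.

Lemma monomial_at_1 k p q a : monomial k p q a 1 = k * Rpower a p.
Proof.
unfold monomial, Rpower at 2; rewrite ln_1, Rmult_0_r, exp_0; ring.
Qed.

Lemma G_mpf_gauss_power sigma chi w rho :
  0 < sigma -> C2_quadrant w -> homogeneous_quadrant chi w ->
  0 < rho < 1 -> 0 < d_b w rho 1 -> 0 < alpha w rho 1 ->
  G_mpf (gauss_power sigma) w rho 1 <= 0 ->
  let s := sigma / 2 in
  let beta := rho * alpha w rho 1 in
  s - 1 + 2 * s * beta + (s - 1) * beta ^ 2
  + rho ^ 2 * d_a (alpha w) rho 1 * (1 - beta)
  - 2 * rho / (1 - rho) * (1 + beta) <= 0.
Proof.
intros Hs HC Hh [H0 H1] Hb Hal HG s beta.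
assert (HF := fun a b => gauss_power_monomial sigma a b Hs).
fold s in HF.
pose proof (d_a_monomial _ _ _ _ HF) as Fa.
pose proof (d_b_monomial _ _ _ _ HF) as Fb.
pose proof (d_a_monomial _ _ _ _ Fa rho 1 H0 Rlt_0_1) as Faa.
pose proof (d_b_monomial _ _ _ _ Fa rho 1 H0 Rlt_0_1) as Fab.
pose proof (d_b_monomial _ _ _ _ Fb rho 1 H0 Rlt_0_1) as Fbb.
specialize (Fa rho 1 H0 Rlt_0_1); specialize (Fb rho 1 H0 Rlt_0_1).
rewrite monomial_at_1 in Fa, Fb, Faa, Fab, Fbb.
assert (Hp : 0 < Rpower rho s) by apply exp_pos.
assert (Hs0 : 0 < s) by (unfold s; lra).
clearbody s.
assert (Hwa : d_a w rho 1 = - alpha w rho 1 * d_b w rho 1)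
  by (unfold alpha; field; lra).
unfold G_mpf in HG.
(* The Hessian of [w] must be replaced before [hess_alpha] is unfolded for [F]. *)
rewrite (hess_alpha_homogeneous chi) in HG by (auto; lra).
unfold hess_alpha in HG.
rewrite Hwa, Fa, Fb, Faa, Fab, Fbb, !Rpower_pred in HG by assumption.
set (A := alpha w rho 1) in *; set (W := d_b w rho 1) in *.
set (D := d_a (alpha w) rho 1) in *; set (T := Rpower rho s) in *.
match goal with |- ?x <= 0 => set (X := x) end.
(* The factor collects F_b = [s * T], w_b = [W], the prefactor of G and the [1 / rho ^ 2] absorbed
   into [beta] and [rho ^ 2 * D]. *)
match type of HG with ?g <= 0 =>
  replace g with (s * T * W / (rho ^ 2 * A ^ 2) * X) in HG end.
2: { unfold X, beta; field; lra. }
assert (Hk : 0 < s * T * W / (rho ^ 2 * A ^ 2)).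
{ apply Rdiv_lt_0_compat.
  - repeat apply Rmult_lt_0_compat; assumption.
  - apply Rmult_lt_0_compat; apply pow_lt; assumption. }
destruct (Rle_or_lt X 0) as [HX|HX]; auto.
pose proof (Rmult_lt_0_compat _ _ Hk HX); lra.
Qed.

Lemma at_right_0_lt d : 0 < d -> at_right 0 (fun x => 0 < x < d).
Proof.
intros Hd; exists (mkposreal d Hd); intros y Hy Hy0; split; auto.
apply Rabs_def2 in Hy; simpl in Hy; unfold minus, plus, opp in Hy; simpl in Hy.
lra.
Qed.

Theorem theorem7p3 (sigma : R) (hsigma : 2 < sigma) :
  ~ exists w : R -> R -> R, is_MPF (gauss_power sigma) w.
Proof.
intros [w (Hsym & HC & (chi & _ & Hh & _) & _ & _ & Hneg & Hpos & _ & HEG & Has)].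
assert (Hcon : contracting (gauss_power sigma)).
{ intros a b Ha Hb; unfold gauss_power; rewrite sign_eq_1 by lra.
  rewrite Rmult_1_l; apply exp_pos. }
destruct Has as (c & _ & Hc & Has & _); specialize (Has Hcon).
set (s := sigma / 2); assert (Hs : 1 < s) by (unfold s; lra).
assert (HG : forall rho, 0 < rho < 1 -> 0 < alpha w rho 1 /\
  let beta := rho * alpha w rho 1 in
  s - 1 + 2 * s * beta + (s - 1) * beta ^ 2
  + rho ^ 2 * d_a (alpha w) rho 1 * (1 - beta)
  - 2 * rho / (1 - rho) * (1 + beta) <= 0).
{ intros rho Hr.
  (* By symmetry w_b at (rho, 1) is w_a at (1, rho), on the side where it is positive. *)
  assert (Hwb : 0 < d_b w rho 1).
  { replace (d_b w rho 1) with (d_a w 1 rho); [apply Hpos; lra|].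
    unfold d_a, d_b; apply Derive_ext_loc, locally_pos; [lra|].
    intros x Hx; apply Hsym; lra. }
  assert (Hal : 0 < alpha w rho 1).
  { unfold alpha; apply Rdiv_lt_0_compat; auto.
    assert (d_a w rho 1 < 0) by (apply Hneg; lra); lra. }
  split; auto.
  apply (G_mpf_gauss_power sigma chi); auto; [lra|].
  apply HEG; lra. }
(* The errors below total at most [3 * e * (1 + beta)], and [3 * e < s - 1]. *)
set (e := (s - 1) / 4); assert (He : 0 < e) by (unfold e; lra).
assert (Hsmall : at_right 0 (fun rho =>
  0 < rho < 1 /\ 2 * rho / (1 - rho) < e)).
{ apply filter_imp with (fun rho => 0 < rho < e / (2 + e)).
  2: { apply at_right_0_lt, Rdiv_lt_0_compat; lra. }
  intros rho [H0 H1]; apply Rlt_div_r in H1; [|lra].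
  assert (H2 : rho < 1) by nra.
  split; [lra|]; apply Rlt_div_l; nra. }
destruct Has as [H | [H1 H2]].
(* Constant alpha: the alpha_a term vanishes, and [s - 1 + 2 * s * beta] exceeds
   [e * (1 + beta)]. *)
- destruct (filter_ex _ (filter_and _ _ Hsmall H)) as (r & [Hr Hre] & Hal & Hd).
  destruct (HG r Hr) as [Hp HX]; unfold alpha_a_1 in Hd; rewrite Hd in HX.
  revert HX; set (beta := r * alpha w r 1).
  assert (0 < beta) by (apply Rmult_lt_0_compat; lra).
  set (q := 2 * r / (1 - r)) in *; cbv zeta; unfold e in *; nra.
- specialize (H1 (mkposreal e He)); specialize (H2 (mkposreal e He)).
  destruct (filter_ex _ (filter_and _ _ Hsmall (filter_and _ _ H1 H2)))
    as (r & [Hr Hre] & K1 & K2).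
  destruct (HG r Hr) as [Hp HX].
  unfold norm in K1, K2; simpl in K1, K2; unfold abs in K1, K2; simpl in K1, K2.
  unfold alpha_1, alpha_a_1 in K1, K2.
  rewrite (Rabs_pos_eq (/ r)) in K1, K2
    by (apply Rlt_le, Rinv_0_lt_compat; lra).
  revert HX; set (beta := r * alpha w r 1); set (gamma := r ^ 2 * d_a (alpha w) r 1).
  assert (0 < beta) by (apply Rmult_lt_0_compat; lra).
  assert (L1 : Rabs (beta - c) <= e).
  { replace (beta - c) with (r * (alpha w r 1 - c / r)) by (unfold beta; field; lra).
    rewrite Rabs_mult, (Rabs_pos_eq r) by lra.
    replace e with (r * (e * / r)) by (field; lra).
    apply Rmult_le_compat_l; lra. }
  (* Multiplying by [r ^ 2] makes the error [r * e], which is below [e] as [r < 1]. *)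
  assert (L2 : Rabs (gamma + c) <= e).
  { replace (gamma + c) with (r ^ 2 * (d_a (alpha w) r 1 - - (c / r ^ 2)))
      by (unfold gamma; field; lra).
    rewrite Rabs_mult, (Rabs_pos_eq (r ^ 2)) by nra.
    apply Rle_trans with (r ^ 2 * (e * / r)).
    - apply Rmult_le_compat_l; [nra | exact K2].
    - replace (r ^ 2 * (e * / r)) with (r * e) by (field; lra); nra. }
  apply Rabs_le_between in L1; apply Rabs_le_between in L2.
  (* Adding [L1] and [L2] cancels [c], so |gamma + beta| is at most [2 * e], while |1 - beta| is at
     most [1 + beta]. *)
  assert (M : - (2 * e * (1 + beta)) <= (gamma + beta) * (1 - beta)).
  { destruct (Rle_or_lt beta 1); nra. }
  (* As gamma (1 - beta) = (gamma + beta)(1 - beta) - beta + beta^2, the left side is at least (s-1)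
     + (2s-1) beta + s beta^2 - 3e (1 + beta) > 0. *)
  set (q := 2 * r / (1 - r)) in *; cbv zeta; unfold e in *; nra.
Qed.
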